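(* Let $n\ge 1$ be an integer, let $\Lambda$ be an Artin algebra and let $\mathscr{M}$ be an $n$-cluster tilting subcategory of $\mathrm{mod}\,\Lambda$. Let $\mathscr{X}\subseteq\mathscr{M}$ be a full subcategory which is an $n$-special precovering class and is closed under direct summands. Then $\mathscr{X}$ is an $n$-cotorsion class (in $\mathscr{M}$).
   Context: $\mathrm{mod}\,\Lambda$ is the category of finitely generated right $\Lambda$-modules. An additive full subcategory $\mathscr{M}$ of an abelian category $\mathscr{A}$ is called $n$-cluster tilting if: it is functorially finite in $\mathscr{A}$ (every object of $\mathscr{A}$ has a right and a left $\mathscr{M}$-approximation); it is generating and cogenerating (for every $a\in\mathscr{A}$ there are an epimorphism $m\to a$ and a monomorphism $a\to m'$ with $m,m'\in\mathscr{M}$); and $$\mathscr{M}=\{a\in\mathscr{A}\mid \mathrm{Ext}^i_{\mathscr{A}}(\mathscr{M},a)=0,\ 0<i<n\}=\{a\in\mathscr{A}\mid \mathrm{Ext}^i_{\mathscr{A}}(a,\mathscr{M})=0,\ 0<i<n\}.$$ An $n$-exact sequence in $\mathscr{M}$ is an exact sequence $0\to m_{n+1}\to m_n\to\cdots\to m_1\to m_0\to 0$ in $\mathrm{mod}\,\Lambda$ with all terms in $\mathscr{M}$. For a full subcategory $\mathscr{X}\subseteq\mathscr{M}$, $\mathscr{X}\text{-}\mathrm{exact}_n$ denotes the class of all sequences of morphisms $m_n\to m_{n-1}\to\cdots\to m_1$ in $\mathscr{M}$ such that for all $x\in\mathscr{X}$ the induced sequence $0\to\mathrm{Ext}^n_{\Lambda}(x,m_n)\to\mathrm{Ext}^n_{\Lambda}(x,m_{n-1})\to\cdots\to\mathrm{Ext}^n_{\Lambda}(x,m_1)\to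 0$ of abelian groups is exact. ${}^{\perp}(\mathscr{X}\text{-}\mathrm{exact}_n)$ denotes the full subcategory of $\mathscr{M}$ of all $m\in\mathscr{M}$ such that for every sequence $m_n\to\cdots\to m_1$ in $\mathscr{X}\text{-}\mathrm{exact}_n$ the induced sequence $0\to\mathrm{Ext}^n_{\Lambda}(m,m_n)\to\cdots\to\mathrm{Ext}^n_{\Lambda}(m,m_1)\to 0$ is exact. $\mathscr{X}$ is an $n$-cotorsion class if $\mathscr{X}={}^{\perp}(\mathscr{X}\text{-}\mathrm{exact}_n)$. $\mathscr{X}$ is an $n$-special precovering class if for every $m\in\mathscr{M}$ there is an $n$-exact sequence $0\to r_n\to\cdots\to r_1\to x\to m\to 0$ in $\mathscr{M}$ with $x\in\mathscr{X}$ and $(r_n\to\cdots\to r_1)\in\mathscr{X}\text{-}\mathrm{exact}_n$. *)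

(* Defs.v *)
From HB Require Import structures.
From mathcomp Require Import all_boot all_algebra.
From mathcomp Require Import finmap.
From mathcomp Require Import boolp functions.
From mathcomp Require monalg.

Set Implicit Arguments.
Unset Strict Implicit.
Unset Printing Implicit Defensive.

Import GRing.Theory.
Local Open Scope ring_scope.
Local Open Scope quotient_scope.

Definition iso (R : pzRingType) (U V : lmodType R) : Prop :=
  exists f : {linear U -> V}, bijective f.

(* Monomorphisms and epimorphisms of modules are the injective and the
   surjective homomorphisms. *)
Definition surj (A B : Type) (f : A -> B) : Prop := forall b, exists a, f a = b.

Definition finitely_generated (R : pzRingType) (U : lmodType R) : Prop :=
  exists r (e : 'I_r -> U), forall u, exists c : 'I_r -> R,
    u = \sum_(i < r) c i *: e i.

Definition projective (R : pzRingType) (P : lmodType R) : Prop :=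
  forall (U V : lmodType R) (p : {linear U -> V}) (f : {linear P -> V}),
    surj p -> exists g : {linear P -> U}, forall x, p (g x) = f x.

(* The descending chain condition on ideals, i.e. submodules of k^o. *)
Definition artinian (k : comPzRingType) : Prop :=
  forall I : nat -> {pred k^o},
    (forall j, submod_closed (I j)) -> (forall j, {subset I j.+1 <= I j}) ->
    exists N, forall j, (N <= j)%N -> I j =i I N.

Definition artin_algebra (k : comPzRingType) (L : algType k) : Prop :=
  artinian k /\ finitely_generated L.

(* Right modules are left modules over the opposite ring. *)
Notation rmodType L := (lmodType L^c).

(* A sequence ... -> c 2 -> c 1 -> c 0; a finite sequence c (n-1) -> ... -> c 0
   is encoded by a chain of which only the first n objects are considered. *)
Record chain (R : pzRingType) := Chain {
  cobj :> nat -> lmodType R;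
  cdif : forall j, {linear cobj j.+1 -> cobj j}
}.

Definition augment_obj (R : pzRingType) (c : chain R) (U : lmodType R)
    (j : nat) : lmodType R := if j is j'.+1 then c j' else U.

(* ... -> c 1 -> c 0 -> U *)
Definition augment (R : pzRingType) (c : chain R) (U : lmodType R)
    (q : {linear c 0%N -> U}) : chain R :=
  @Chain R (augment_obj c U)
    (fun j => match j return
       {linear augment_obj c U j.+1 -> augment_obj c U j} with
     | 0 => q
     | j'.+1 => cdif c j'
     end).

Section Exactness.
Variables (A : nat -> zmodType) (phi : forall j, A j.+1 -> A j).

(* The kernel of the map out of A j, the map out of A 0 being A 0 -> 0. *)
Definition in_ker (j : nat) : A j -> Prop :=
  match j with
  | 0 => fun=> True
  | j'.+1 => fun a => phi a = 0
  end.

Definition in_im (j : nat) (a : A j) : Prop := exists b : A j.+1, phi b = a.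

(* ... -> A 1 -> A 0 -> 0 is exact *)
Definition exact_seq : Prop := forall j (a : A j), in_ker a <-> in_im a.

(* 0 -> A (n-1) -> ... -> A 1 -> A 0 -> 0 is exact *)
Definition exact_seq_upto (n : nat) : Prop :=
  forall j, (j < n)%N -> forall a : A j,
    in_ker a <-> if j.+1 == n then a = 0 else in_im a.

End Exactness.

Record resolution (R : pzRingType) (U : lmodType R) := Resolution {
  res_chain :> chain R;
  res_aug : {linear res_chain 0%N -> U};
  res_projective : forall j, projective (res_chain j);
  res_exact : exact_seq (fun j => cdif (augment res_aug) j)
}.

Section FreeModule.
Variables (R : nzRingType) (K : choiceType).
Import monalg.
Local Open Scope fset_scope.

Definition free : lmodType R := {malg R[K]}.

Definition free_lift (V : lmodType R) (h : K -> V) (g : free) : V :=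
  \sum_(x <- msupp g) g@_x *: h x.

Section Lift.
Variables (V : lmodType R) (h : K -> V).

Lemma free_liftEw (D : {fset K}) (g : free) : msupp g `<=` D ->
  free_lift h g = \sum_(x <- D) g@_x *: h x.
Proof.
move=> le; rewrite /free_lift (big_fset_incl _ le) //= => x xd.
move=> /mcoeff_outdom ->.
by rewrite scale0r.
Qed.

Lemma free_lift_linear : linear (free_lift h).
Proof.
move=> a g1 g2; pose D := msupp (a *: g1 + g2) `|` (msupp g1 `|` msupp g2).
have D1 : msupp g1 `<=` D by apply/fsubsetP=> x; rewrite !in_fsetE orbC => ->.
have D2 : msupp g2 `<=` D.
  by apply/fsubsetP=> x; rewrite !in_fsetE !orbA orbC => ->.
rewrite (free_liftEw D1) (free_liftEw D2) (@free_liftEw D) ?fsubsetUl //.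
rewrite scaler_sumr -big_split /=; apply: eq_bigr => x _.
by rewrite mcoeffD mcoeffZ scalerDl scalerA.
Qed.

HB.instance Definition _ :=
  GRing.isLinear.Build R free V *:%R (free_lift h) free_lift_linear.

Lemma free_liftU (x : K) : free_lift h (mkmalgU x 1) = h x.
Proof. by rewrite (free_liftEw msuppU_le) big_seq_fset1 mcoeffUU scale1r. Qed.

Lemma free_ext (f g : {linear free -> V}) :
  (forall x, f (mkmalgU x 1) = g (mkmalgU x 1)) -> forall u : free, f u = g u.
Proof.
move=> fg u; rewrite [u]monalgE !linear_sum /=; apply: eq_bigr => x _.
have -> : mkmalgU x u@_x = u@_x *: mkmalgU x 1 :> free.
  by apply/malgP=> y; rewrite mcoeffZ !mcoeffU mulrnAr mulr1.
by rewrite !linearZ /= fg.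
Qed.

End Lift.

Lemma free_projective : projective free.
Proof.
move=> U V p f /choice[s ps].
exists (free_lift (fun x => s (f (mkmalgU x 1)))) => u.
by apply: (@free_ext V (p \o free_lift _) f) => x; rewrite /= free_liftU ps.
Qed.

End FreeModule.

Section Kernel.
Variables (R : pzRingType) (U V : lmodType R) (f : {linear U -> V}).

Definition kernel_pred : {pred U} := [pred u | f u == 0].

Lemma kernel_submod_closed : submod_closed kernel_pred.
Proof.
split=> [|a u v]; rewrite !inE ?linear0 // => /eqP fu /eqP fv.
by rewrite linearP fu fv scaler0 addr0.
Qed.

HB.instance Definition _ :=
  GRing.isSubmodClosed.Build R U kernel_pred kernel_submod_closed.

Record kernel := Kernel { kernel_val : U; _ : kernel_val \in kernel_pred }.

HB.instance Definition _ := [isSub for kernel_val].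
HB.instance Definition _ := [Choice of kernel by <:].
HB.instance Definition _ := [SubChoice_isSubLmodule of kernel by <:].

End Kernel.

(* The resolution by the free modules on the underlying sets of the iterated
   kernels, starting from U; it is in general not finitely generated. *)
Section CanonicalResolution.
Variables (R : nzRingType) (U : lmodType R).

Definition free_cover (V : lmodType R) : {linear free R V -> V} :=
  free_lift (@idfun V).

Fixpoint syzygy (j : nat) : lmodType R :=
  if j is j'.+1 then kernel (free_cover (syzygy j')) else U.

Definition free_chain : chain R :=
  @Chain R (fun j => free R (syzygy j))
    (fun j => (val : kernel (free_cover (syzygy j)) -> free R (syzygy j))
                \o free_cover (syzygy j.+1)).

Lemma free_cover_surj (V : lmodType R) : surj (free_cover V).
Proof. by move=> v; exists (monalg.mkmalgU v 1); rewrite [LHS]free_liftU. Qed.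

Lemma free_chain_exact :
  exact_seq (fun j => cdif (@augment R free_chain U (free_cover U)) j).
Proof.
have im j (a : free R (syzygy j)) : free_cover (syzygy j) a = 0 <->
    exists b, cdif free_chain j b = a.
  split=> [/eqP a0|[b <-]]; last exact/eqP/(valP (free_cover (syzygy j.+1) b)).
  have [b bE] := free_cover_surj (Kernel (a0 : a \in kernel_pred _)).
  by exists b; rewrite /= bE.
case=> [|[|j]] /= a.
- by split=> // _; exact: free_cover_surj.
- exact: (im 0%N).
apply: iff_trans (im j.+1 a); split=> [a0|/= -> //].
exact: val_inj.
Qed.

Definition free_resolution : resolution U :=
  @Resolution R U free_chain (free_cover U)
    (fun j => @free_projective R (syzygy j)) free_chain_exact.

End CanonicalResolution.

Definition is_coboundary (R : pzRingType) (P : chain R) (i : nat)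
    (V : lmodType R) : (P i -> V) -> Prop :=
  match i with
  | 0 => fun f => forall x, f x = 0
  | i'.+1 => fun f => exists g : {linear P i' -> V},
      forall x, f x = g (cdif P i' x)
  end.

(* The i-th cohomology group of the complex
   0 -> Hom(P 0, V) -> Hom(P 1, V) -> Hom(P 2, V) -> ... *)
Section Cocycle.
Variables (R : pzRingType) (P : chain R) (i : nat) (V : lmodType R).

Definition cocycle_pred : {pred P i -> V} :=
  [pred f | `[< linear f /\ forall x, f (cdif P i x) = 0 >]].

Lemma cocycle_zmod_closed : zmod_closed cocycle_pred.
Proof.
split=> [|f g]; rewrite !inE.
  apply/asboolP; split=> // a u v.
  by rewrite /GRing.zero /= scaler0 addr0.
move=> /asboolP[lf zf] /asboolP[lg zg]; apply/asboolP; split=> [a u v|x].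
  rewrite -[LHS]/(f _ - g _) -[in RHS]/(a *: (f u - g u) + (f v - g v)).
  by rewrite lf lg scalerBr opprD addrACA.
by rewrite -[LHS]/(f _ - g _) zf zg subr0.
Qed.

HB.instance Definition _ :=
  GRing.isZmodClosed.Build (P i -> V) cocycle_pred cocycle_zmod_closed.

Record cocycle :=
  Cocycle { cocycle_val :> P i -> V; _ : cocycle_val \in cocycle_pred }.

HB.instance Definition _ := [isSub for cocycle_val].
HB.instance Definition _ := [Choice of cocycle by <:].
HB.instance Definition _ := [SubChoice_isSubZmodule of cocycle by <:].

End Cocycle.

Section Cohomology.
Variables (R : pzRingType) (P : chain R) (i : nat) (V : lmodType R).

Definition coboundary_pred : {pred cocycle P i V} :=
  [pred z | `[< is_coboundary (cocycle_val z) >]].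

Lemma coboundary_zmod_closed : zmod_closed coboundary_pred.
Proof.
split=> [|f g]; rewrite !inE.
  apply/asboolP; case: (i) => [//|j] /=.
  by exists (\0 : {linear P j -> V}).
move=> /asboolP bf /asboolP bg; apply/asboolP.
case: (i) f g bf bg => [|j] /= f g.
  by move=> f0 g0 x; rewrite -[LHS]/(f x - g x) f0 g0 subr0.
move=> [f' fE] [g' gE]; exists (f' \- g') => x.
by rewrite -[LHS]/(f x - g x) fE gE.
Qed.

HB.instance Definition _ :=
  GRing.isZmodClosed.Build (cocycle P i V) coboundary_pred
    coboundary_zmod_closed.

Definition cohomology : zmodType := {ideal_quot coboundary_pred}.

Definition cohomology_class (z : cocycle P i V) : cohomology :=
  \pi_({ideal_quot coboundary_pred}) z.

Definition cohomology_repr (e : cohomology) : cocycle P i V :=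
  repr (e : {ideal_quot coboundary_pred}).

Lemma cohomology_reprK : cancel cohomology_repr cohomology_class.
Proof. exact: reprK. Qed.

Lemma cohomology_class_eq (y z : cocycle P i V) :
  cohomology_class y = cohomology_class z <->
    is_coboundary (cocycle_val (y - z)%R).
Proof.
have -> : (cohomology_class y = cohomology_class z) <->
    y - z \in coboundary_pred by rewrite Quotient.idealrBE; split=> /eqP.
by split=> [/asboolP|b]; last exact/asboolP.
Qed.

Lemma cohomology_class_zmod : zmod_morphism cohomology_class.
Proof. by move=> y z; rewrite /cohomology_class -raddfB. Qed.

HB.instance Definition _ :=
  GRing.isZmodMorphism.Build (cocycle P i V) cohomology cohomology_class
    cohomology_class_zmod.

End Cohomology.

Lemma is_coboundary_comp (R : pzRingType) (P : chain R) (i : nat)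
    (V W : lmodType R) (h : {linear V -> W}) (f : P i -> V) :
  is_coboundary f -> is_coboundary (i := i) (h \o f).
Proof.
case: i f => [|i] f /= => [f0 x|[g fE]]; first by rewrite /= f0 linear0.
by exists (h \o g) => x; rewrite /= fE.
Qed.

Section CohomologyMap.
Variables (R : pzRingType) (P : chain R) (i : nat) (V W : lmodType R).
Variable h : {linear V -> W}.

Lemma cocycle_comp (z : cocycle P i V) : h \o z \in @cocycle_pred R P i W.
Proof.
have /asboolP[lz dz] := valP z; apply/asboolP; split=> [a u v|x] /=.
  by rewrite -[val z]/(cocycle_val z) in lz *; rewrite lz linearP.
by rewrite (dz x) linear0.
Qed.

Definition cocycle_map (z : cocycle P i V) : cocycle P i W :=
  Cocycle (cocycle_comp z).

Definition cohomology_map (e : cohomology P i V) : cohomology P i W :=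
  cohomology_class (cocycle_map (cohomology_repr e)).

Lemma cohomology_mapE (z : cocycle P i V) :
  cohomology_map (cohomology_class z) = cohomology_class (cocycle_map z).
Proof.
have /cohomology_class_eq := cohomology_reprK (cohomology_class z).
rewrite /cohomology_map; move: (cohomology_repr _) => y byz.
apply/cohomology_class_eq.
have -> : cocycle_val (cocycle_map y - cocycle_map z) = h \o (y - z).
  by apply/funext => x; rewrite /= [RHS]linearB.
exact: is_coboundary_comp.
Qed.

Lemma cohomology_map_zmod : zmod_morphism cohomology_map.
Proof.
move=> a b; rewrite -[a]cohomology_reprK -[b]cohomology_reprK.
rewrite -raddfB !cohomology_mapE -raddfB /=.
congr cohomology_class; apply/val_inj/funext => x /=.
by rewrite -[LHS]/(h (_ - _)) linearB.
Qed.

HB.instance Definition _ :=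
  GRing.isZmodMorphism.Build (cohomology P i V) (cohomology P i W)
    cohomology_map cohomology_map_zmod.

End CohomologyMap.

(* Ext in the category of all modules; over an Artin algebra, which is
   noetherian, it agrees on finitely generated modules with Ext computed in
   the category of finitely generated modules. *)
Section Ext.
Variables (R : nzRingType) (i : nat) (U : lmodType R).

Definition Ext (V : lmodType R) : zmodType :=
  cohomology (free_resolution U) i V.

Definition Ext_map (V W : lmodType R) (h : {linear V -> W}) :
  {additive Ext V -> Ext W} := cohomology_map (P := free_resolution U) h.

End Ext.

Section ClusterTilting.
Variables (k : comPzRingType) (L : algType k).

(* A full subcategory is given by the predicate selecting its objects; the
   category mod L is the predicate finitely_generated on right modules. *)
Implicit Types M X : rmodType L -> Prop.

Definition additive_subcat M : Prop :=
  (exists2 Z : rmodType L, M Z & forall z : Z, z = 0) /\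
  (forall U V, M U -> M V ->
    exists2 W, M W & iso W (U * V)%type).

Definition functorially_finite M : Prop :=
  forall A : rmodType L, finitely_generated A ->
    (exists (U : rmodType L) (f : {linear U -> A}), M U /\
      forall (U' : rmodType L) (g : {linear U' -> A}), M U' ->
        exists h : {linear U' -> U}, forall x, g x = f (h x)) /\
    (exists (U : rmodType L) (f : {linear A -> U}), M U /\
      forall (U' : rmodType L) (g : {linear A -> U'}), M U' ->
        exists h : {linear U -> U'}, forall x, g x = h (f x)).

Definition generating_cogenerating M : Prop :=
  forall A : rmodType L, finitely_generated A ->
    (exists (U : rmodType L) (f : {linear U -> A}), M U /\ surj f) /\
    (exists (U : rmodType L) (f : {linear A -> U}), M U /\ injective f).

Definition Ext_vanishes (i : nat) (U V : rmodType L) : Prop :=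
  forall e : Ext i U V, e = 0.

Definition cluster_tilting (n : nat) M : Prop :=
  [/\ additive_subcat M,
      functorially_finite M,
      generating_cogenerating M,
      forall A, M A <-> finitely_generated A /\
        (forall i, (0 < i < n)%N -> forall U, M U -> Ext_vanishes i U A)
    & forall A, M A <-> finitely_generated A /\
        (forall i, (0 < i < n)%N -> forall U, M U -> Ext_vanishes i A U)].

Variables (n : nat) (M X : rmodType L -> Prop).

(* 0 -> Ext^n(U, c (n-1)) -> ... -> Ext^n(U, c 0) -> 0 is exact *)
Definition Ext_exact (U : rmodType L) (c : chain L^c) : Prop :=
  exact_seq_upto (fun j => Ext_map n U (cdif c j)) n.

(* The term m_i of a sequence m_n -> ... -> m_1 is c (i - 1). *)
Definition X_exact (c : chain L^c) : Prop :=
  (forall j, (j < n)%N -> M (c j)) /\ (forall U, X U -> Ext_exact U c).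

Definition perp_X_exact (U : rmodType L) : Prop :=
  M U /\ forall c, X_exact c -> Ext_exact U c.

Definition cotorsion_class : Prop := forall U, X U <-> perp_X_exact U.

Definition special_precovering : Prop :=
  forall U, M U ->
    exists (V : rmodType L) (p : {linear V -> U})
           (r : chain L^c) (q : {linear r 0%N -> V}),
      [/\ X V, X_exact r
        & exact_seq_upto
            (fun j => cdif (@augment _ (@augment _ r V q) U p) j) n.+2].

Definition closed_under_summands : Prop :=
  forall U V W : rmodType L, X W -> iso W (U * V)%type -> X U.

End ClusterTilting.

(* Main.v *)
Require Import Defs.
From HB Require Import structures.
From mathcomp Require Import all_boot all_algebra.
From mathcomp Require Import boolp.

(** Let [U] be in the orthogonal class and take its special precover
    [0 -> r_n -> ... -> r_1 -> V -> U -> 0].  Lift the identity of [U] to a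
    chain map from a projective resolution [P] of [U] to this sequence.  Its
    component [P_n -> r_n] is a cocycle that becomes a coboundary in
    [r_(n-1)], hence is itself a coboundary because [Ext^n(U, -)] is exact on
    [r].  As [Ext^i(U, r_i)] vanishes for [0 < i < n], the lift can then be
    corrected degree by degree, from [n] down to [0], until [P_0 -> V] kills
    the image of [P_1]; it then induces a section of [V -> U], so that [U] is a
    summand of [V]. *)

Set Implicit Arguments.
Unset Strict Implicit.
Unset Printing Implicit Defensive.

Import GRing.Theory.
Local Open Scope ring_scope.

Section Modules.
Variable R : pzRingType.

Lemma exists_linear (U V : lmodType R) (f : U -> V) :
  linear f -> exists g : {linear U -> V}, g =1 f.
Proof.
move=> lf; pose m := GRing.isLinear.Build R U V *:%R f lf.
by exists (HB.pack_for {linear U -> V} f m).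
Qed.

(** Exactness at [B] makes the corestriction of [p] to [kernel q] surjective, and [h] also
    corestricts to it. *)
Lemma projective_lift_exact (P A B C : lmodType R) (p : {linear A -> B})
    (q : {linear B -> C}) (h : {linear P -> B}) :
  projective P -> (forall b, q b = 0 <-> exists a, p a = b) ->
  (forall x, q (h x) = 0) -> exists g : {linear P -> A}, forall x, p (g x) = h x.
Proof.
move=> projP ex qh0.
have qp0 a : p a \in kernel_pred q by apply/eqP/ex; exists a.
have hK x : h x \in kernel_pred q by apply/eqP.
have [|p' p'E] := @exists_linear A (kernel q) (fun a => Kernel (qp0 a)).
  by move=> a u v; apply: val_inj; rewrite /= linearP.
have [|h' h'E] := @exists_linear P (kernel q) (fun x => Kernel (hK x)).
  by move=> a u v; apply: val_inj; rewrite /= linearP.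
have [|g gE] := projP _ _ p' h'.
  move=> [b b0]; have /ex[a pa] : q b = 0 by apply/eqP.
  by exists a; apply: val_inj; rewrite p'E.
by exists g => x; have := congr1 val (gE x); rewrite p'E h'E.
Qed.

Lemma factor_through_surj (P U V : lmodType R) (e : {linear P -> U})
    (f : {linear P -> V}) :
  surj e -> (forall x, e x = 0 -> f x = 0) ->
  exists s : {linear U -> V}, forall x, s (e x) = f x.
Proof.
move=> /choice[t et] ker.
have fE x y : e x = e y -> f x = f y.
  move=> exy; apply/eqP; rewrite -subr_eq0 -linearB; apply/eqP/ker.
  by rewrite linearB exy subrr.
have [|s sE] := @exists_linear U V (f \o t).
  by move=> a u v; rewrite /= -linearP; apply: fE; rewrite linearP !et.
by exists s => x; rewrite sE; apply: fE; rewrite et.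
Qed.

Lemma iso_section (U V : lmodType R) (p : {linear V -> U})
    (s : {linear U -> V}) :
  cancel s p -> iso V (U * kernel p)%type.
Proof.
move=> ps.
have kerP v : v - s (p v) \in kernel_pred p.
  by apply/eqP; rewrite linearB ps subrr.
have [|f fE] := @exists_linear V (U * kernel p)%type
    (fun v => (p v, Kernel (kerP v))).
  move=> a u v; congr (_, _); first by rewrite linearP.
  apply: val_inj => /=; rewrite -[RHS]/(a *: (u - s (p u)) + (v - s (p v))).
  by rewrite linearP [s _]linearP scalerBr opprD addrACA.
exists f, (fun w => s w.1 + val w.2) => [v|[u [v v0]]]; rewrite fE /=.
  by rewrite addrC subrK.
have pv : p v = 0 by apply/eqP.
congr (_, _); first by rewrite linearD ps pv addr0.
by apply: val_inj; rewrite /= linearD ps pv addr0 addrC addKr.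
Qed.

(* The cocycles occurring in the last hypothesis are those that become
   coboundaries after composition with the differential of [E]. *)
Lemma correct_lift (n : nat) (A E : chain R) :
  (forall j, projective (A j.+1)) ->
  (forall j x, cdif A j (cdif A j.+1 x) = 0) ->
  exact_seq_upto (fun j => cdif E j) n.+2 ->
  (forall j (f : {linear A j.+2 -> E j.+2}) (h : {linear A j.+1 -> E j.+1}),
    (j < n)%N -> (forall x, f (cdif A j.+2 x) = 0) ->
    (forall x, cdif E j.+1 (f x) = h (cdif A j.+1 x)) ->
    exists g : {linear A j.+1 -> E j.+2}, forall x, f x = g (cdif A j.+1 x)) ->
  forall j (f : {linear A j.+1 -> E j.+1}), (j <= n)%N ->
    (forall x, cdif E j (f (cdif A j.+1 x)) = 0) ->
    exists2 f' : {linear A j.+1 -> E j.+1},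
      forall x, cdif E j (f' x) = cdif E j (f x) &
      forall x, f' (cdif A j.+1 x) = 0.
Proof.
move=> projA dd0 exE cobound j f le_jn.
move: {2}(n - j)%N (erefl (n - j)%N) => m.
elim: m j f le_jn => [|m IHm] j f le_jn jm fd0.
  (* At the left end [cdif E n] is injective, so [f] needs no correction. *)
  have jn : j = n by apply/eqP; rewrite eqn_leq le_jn -subn_eq0 jm.
  subst n; exists f => // x; have := exE j.+1 (ltnSn _) (f (cdif A j.+1 x)).
  by rewrite eqxx => -[+ _]; apply.
have lt_jn : (j < n)%N by rewrite -subn_gt0 jm.
(* [g] is the next component of the chain map above [f]. Once corrected to a cocycle [g'], it
   factors as [h \o cdif A j.+1], and [cdif E j.+1 \o h] is what must be subtracted from [f]. *)
have [|x|g gE] := @projective_lift_exact (A j.+2) _ _ _ (cdif E j.+1)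
    (cdif E j) (f \o cdif A j.+1) (projA _).
- by move=> b; have := exE j.+1 (ltnW lt_jn) b; rewrite !eqSS (ltn_eqF lt_jn).
- exact: fd0.
have [|x|g' g'E g'd0] := IHm j.+1 g lt_jn.
- by rewrite subnS jm.
- by rewrite gE /= dd0 linear0.
have [x|h hE] := cobound j g' f lt_jn g'd0; first by rewrite g'E gE.
have EE0 y : cdif E j (cdif E j.+1 y) = 0.
  have [_] := exE j.+1 (ltnW lt_jn) (cdif E j.+1 y).
  by rewrite !eqSS (ltn_eqF lt_jn); apply; exists y.
exists (f \- (cdif E j.+1 \o h)) => x /=; first by rewrite linearB EE0 subr0.
by rewrite -hE g'E gE subrr.
Qed.

Lemma cocycle_linear (P : chain R) (i : nat) (V : lmodType R)
    (f : {linear P i -> V}) :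
  (forall x, f (cdif P i x) = 0) -> (f : P i -> V) \in @cocycle_pred R P i V.
Proof. by move=> fd0; apply/asboolP; split=> // a u v; rewrite linearP. Qed.

Lemma cohomology_class_eq0 (P : chain R) (i : nat) (V : lmodType R)
    (z : cocycle P i V) :
  cohomology_class z = 0 <-> is_coboundary (cocycle_val z).
Proof. by rewrite -[z in X in _ <-> X]subr0 -cohomology_class_eq raddf0. Qed.

End Modules.

Lemma resolution_dd0 (R : pzRingType) (U : lmodType R) (P : resolution U) j x :
  cdif (augment (res_aug P)) j (cdif (augment (res_aug P)) j.+1 x) = 0.
Proof.
by have [_] := res_exact (r := P) (j := j.+1) (cdif _ j.+1 x); apply; exists x.
Qed.

Section Splitting.
Variables (k : comPzRingType) (L : algType k) (n : nat).
Variables (U V : rmodType L) (p : {linear V -> U}).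
Variables (r : chain L^c) (q : {linear r 0%N -> V}).

Lemma precover_section :
  (forall i j, (0 < i < n)%N -> (j < n)%N -> Ext_vanishes i U (r j)) ->
  Ext_exact n U r ->
  exact_seq_upto (fun j => cdif (augment (R := L^c) (c := augment q) p) j) n.+2 ->
  exists s : {linear U -> V}, cancel s p.
Proof.
move=> van exr exE; pose P := free_resolution U.
have psurj : surj p by move=> u; have [/(_ I)] := exE 0%N isT u.
have [f0 f0E] := res_projective (r := P) (j := 0) (res_aug P) psurj.
(* Augmentation shifts the indices: position [j.+2] holds [P j.+1] and [r j], so the obstruction
   there lies in [Ext j.+1 U (r j)]. *)
have [| |j f h lt_jn fd0 fh||x|f' f'E f'd0] := @correct_lift _ n
    (augment (res_aug P)) (augment (R := L^c) (c := augment q) p)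
    _ _ exE _ 0 f0.
- by move=> j; exact: (res_projective (r := P)).
- exact: resolution_dd0.
- pose z := Cocycle (cocycle_linear (P := P) (i := j.+1) (V := r j) fd0).
  suff /cohomology_class_eq0[g gE] : cohomology_class z = 0 by exists g.
  have [lt_j1n|] := ltnP j.+1 n; first exact: van.
  rewrite leq_eqVlt ltnNge lt_jn orbF => /eqP nj.
  move: exr; rewrite /Ext_exact nj => exr.
  have [+ _] := exr j (ltnSn j) (cohomology_class z); rewrite eqxx; apply.
  (* For [n = 1] the sequence [r] has a single term, whose Ext group is zero by exactness. Otherwise
     [h] exhibits the image of [z] in the next term as a coboundary. *)
  case: j f h {lt_jn nj exr} fd0 fh @z => [//|j] f h fd0 fh z.
  rewrite /in_ker /= /Ext_map /=.
  by rewrite cohomology_mapE; apply/cohomology_class_eq0; exists h.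
- by [].
- rewrite [LHS]f0E; exact: (resolution_dd0 (j := 0) x).
(* The image of [P 1] is the kernel of the augmentation, so [f'] descends to [U]. *)
have [e_surj|x e0|s sE] := @factor_through_surj _ _ _ _ (res_aug P) f'.
- by have [/(_ I)] := res_exact (r := P) (j := 0) e_surj.
- have [/(_ e0)[y <-] _] := res_exact (r := P) (j := 1) x.
  exact: f'd0.
exists s => u; have [/(_ I)[x <-] _] := res_exact (r := P) (j := 0) u.
by rewrite sE [LHS]f'E; exact: f0E.
Qed.

End Splitting.

Theorem theorem3p5 (n : nat) (hn : (1 <= n)%N)
    (k : comPzRingType) (L : algType k) (hL : artin_algebra L)
    (M : rmodType L -> Prop) (hM : cluster_tilting n M)
    (X : rmodType L -> Prop) (hXM : forall U, X U -> M U)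
    (hX : special_precovering n M X) (hS : closed_under_summands X) :
  cotorsion_class n M X.
Proof.
move=> U; split=> [XU|[MU perpU]].
  by split=> [|c [_ exc]]; [exact: hXM | exact: exc].
have [V [p [r [q [XV Xr exE]]]]] := hX U MU.
have [_ _ _ Mr _] := hM.
have [|s ps] := precover_section _ (perpU r Xr) exE.
  by move=> i j lt_in lt_jn; have /Mr[_] := Xr.1 j lt_jn; apply.
exact: hS XV (iso_section ps).
Qed.
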